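(* Let $\mathcal{M}'_b: z(u,v)=f(u)\,l(v)+g(u)\,e_4$, $u\in I$, $v\in J$, be a meridian surface of type $\mathcal{M}'_b$ in $\mathbb{E}^4_2$ (so $l$ is a unit-speed timelike curve on $\mathbb{S}^2_1(1)$, $f'^2-g'^2=1$, and $g'$ is nowhere zero). Then $\mathcal{M}'_b$ is minimal if and only if the curve $l$ has zero spherical curvature ($\kappa\equiv0$ on $J$) and the meridian curve $u\mapsto(f(u),g(u))$ is given on $I$ by $$f(u)=\pm\sqrt{u^2+2au+b},\qquad g(u)=\pm\sqrt{a^2-b}\,\ln\left|u+a+\sqrt{u^2+2au+b}\right|+C,$$ for some real constants $a,b,C$ with $a^2-b>0$ and some choice of the two (independent) signs.
   Context: $\mathbb{E}^4_2$ is $\mathbb{R}^4$ with the inner product $\langle x,y\rangle=x_1y_1+x_2y_2-x_3y_3-x_4y_4$ and standard basis $e_1,e_2,e_3,e_4$. A vector $v$ is spacelike if $\langle v,v\rangle>0$ or $v=0$, timelike if $\langle v,v\rangle<0$, lightlike if $\langle v,v\rangle=0$ and $v\ne0$. Let $\mathbb{E}^3_1=\mathrm{span}\{e_1,e_2,e_3\}$ and $\mathbb{S}^2_1(1)=\{V\in\mathbb{E}^3_1:\langle V,V\rangle=1\}$. Meridian surface of type $\mathcal{M}'_b$: let $I,J\subset\mathbb{R}$ be open intervals, $f,g:I\to\mathbb{R}$ smooth with $f$ nowhere zero, $f'^2-g'^2=1$ and $g'$ nowhere zero (equivalently $f'^2>1$), and $l:J\to\mathbb{S}^2_1(1)$ a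 smooth curve with $\langle l',l'\rangle=-1$. The surface is $z(u,v)=f(u)l(v)+g(u)e_4$. Its induced metric is Lorentzian, with orthonormal tangent frame $X=z_u$, $Y=z_v/f=l'$, $\langle X,X\rangle=1$, $\langle Y,Y\rangle=-1$. Spherical curvature: put $t=l'$ and let $n$ be a smooth vector field along $l$ (unique up to sign) such that $\{l,t,n\}$ is an orthonormal frame of $\mathbb{E}^3_1$ with $\langle n,n\rangle=1$; then $\kappa(v)=\langle t'(v),n(v)\rangle$, so that $t'=\kappa n+l$, $n'=\kappa t$. For a Lorentz surface with second fundamental form $h$, the mean curvature vector field is $H=\tfrac12\,\mathrm{tr}\,h=\tfrac12\left(h(E_1,E_1)-h(E_2,E_2)\right)$ for any local orthonormal tangent frame with $\langle E_1,E_1\rangle=1$, $\langle E_2,E_2\rangle=-1$. The surface is minimal if $H=0$ identically. *)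

(* Defs.v *)
From HB Require Import structures.
From mathcomp Require Import all_boot all_order all_algebra.
From mathcomp Require Import ring.
From mathcomp Require Import all_classical all_reals all_analysis.
Import Order.TTheory GRing.Theory Num.Theory.
Import numFieldNormedType.Exports.

Set Implicit Arguments.
Unset Strict Implicit.
Unset Printing Implicit Defensive.

Local Open Scope classical_set_scope.
Local Open Scope ring_scope.

(* Coordinates are numbered from 0: the basis vectors e_1, ..., e_4 are
   [ebasis 0], ..., [ebasis 3], the numerals being read in 'I_4. *)

Section PseudoEuclidean.
Context {R : realType}.
Implicit Types x y w p q : 'rV[R]_4.

Definition dotp x y : R :=
  x 0 0 * y 0 0 + x 0 1 * y 0 1 - x 0 2 * y 0 2 - x 0 3 * y 0 3.

Definition ebasis (i : 'I_4) : 'rV[R]_4 := delta_mx 0 i.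

Definition E31 : set 'rV[R]_4 :=
  [set x | exists a b c : R, x = a *: ebasis 0 + b *: ebasis 1 + c *: ebasis 2].

Definition S21 : set 'rV[R]_4 := [set x | E31 x /\ dotp x x = 1].

(* {p, q, w} is an orthonormal frame of E31 with q the timelike vector. *)
Definition E31_frame p q w : Prop :=
  [/\ E31 p, E31 q & E31 w] /\
  [/\ dotp p p = 1, dotp q q = -1 & dotp w w = 1] /\
  [/\ dotp p q = 0, dotp p w = 0 & dotp q w = 0].

Definition gram_det p q : R := dotp p p * dotp q q - dotp p q ^+ 2.

(* Orthogonal projection of w along span {p, q}, for a nondegenerate plane
   (gram_det p q != 0); see normal_partP and normal_part_unique. *)
Definition normal_part p q w : 'rV[R]_4 :=
  w - ((dotp q q * dotp w p - dotp p q * dotp w q) / gram_det p q) *: p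
    - ((dotp p p * dotp w q - dotp p q * dotp w p) / gram_det p q) *: q.

Lemma normal_partP p q w : gram_det p q != 0 ->
  dotp (normal_part p q w) p = 0 /\ dotp (normal_part p q w) q = 0.
Proof.
have dotpBZ (a b : R) (r : 'rV[R]_4) :
    dotp (w - a *: p - b *: q) r = dotp w r - a * dotp p r - b * dotp q r.
  by rewrite /dotp !mxE; ring.
have dotpC : dotp q p = dotp p q by rewrite /dotp; ring.
rewrite /normal_part !dotpBZ dotpC /gram_det.
by move: (dotp p p) (dotp p q) (dotp q q) => E F G W0; split; field.
Qed.

Lemma normal_part_unique p q w (a b : R) : gram_det p q != 0 ->
  dotp (w - a *: p - b *: q) p = 0 -> dotp (w - a *: p - b *: q) q = 0 ->
  normal_part p q w = w - a *: p - b *: q.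
Proof.
have dotpBZ (r : 'rV[R]_4) :
    dotp (w - a *: p - b *: q) r = dotp w r - a * dotp p r - b * dotp q r.
  by rewrite /dotp !mxE; ring.
have dotpC : dotp q p = dotp p q by rewrite /dotp; ring.
rewrite !dotpBZ dotpC /normal_part /gram_det => W0 /eqP.
rewrite -addrA -opprD subr_eq0 => /eqP -> /eqP.
rewrite -addrA -opprD subr_eq0 => /eqP ->.
by congr (_ - _ *: _ - _ *: _); field.
Qed.

End PseudoEuclidean.

Section Surfaces.
Context {R : realType}.

Definition open_interval (I : set R) : Prop :=
  [/\ open I, is_interval I & I !=set0].

(* For open I this only depends on the values of c on I. *)
Definition smooth_on {V : normedModType R} (I : set R) (c : R -> V) : Prop :=
  forall n x, I x -> derivable (derive1n n c) x 1.

Implicit Types (z : R -> R -> 'rV[R]_4) (u v : R) (x y : R * R).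

Definition partial_u z : R -> R -> 'rV[R]_4 := fun u v => derive1 (z ^~ v) u.
Definition partial_v z : R -> R -> 'rV[R]_4 := fun u v => derive1 (z u) v.

(* Tangent vectors at z(u, v) are given by their coordinates in the basis
   (z_u, z_v): x stands for [tangent z u v x]. *)
Definition tangent z u v x : 'rV[R]_4 :=
  x.1 *: partial_u z u v + x.2 *: partial_v z u v.

(* h(x, y) is the normal component of the ambient derivative
   sum_(i, j) x_i y_j z_ij. *)
Definition second_form z u v x y : 'rV[R]_4 :=
  normal_part (partial_u z u v) (partial_v z u v)
    ((x.1 * y.1) *: partial_u (partial_u z) u v
     + (x.1 * y.2 + x.2 * y.1) *: partial_v (partial_u z) u v
     + (x.2 * y.2) *: partial_v (partial_v z) u v).

Definition lorentz_frame z u v x y : Prop :=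
  [/\ dotp (tangent z u v x) (tangent z u v x) = 1,
      dotp (tangent z u v y) (tangent z u v y) = -1 &
      dotp (tangent z u v x) (tangent z u v y) = 0].

(* The first conjunct says that the surface is Lorentzian at the point, and
   makes H unique. *)
Definition is_mean_curvature_vector z u v (H : 'rV[R]_4) : Prop :=
  (exists x y, lorentz_frame z u v x y) /\
  (forall x y, lorentz_frame z u v x y ->
     H = 2^-1 *: (second_form z u v x x - second_form z u v y y)).

Definition minimal_surface (I J : set R) z : Prop :=
  forall u v, I u -> J v -> is_mean_curvature_vector z u v 0.

(* The normal field n is unique up to sign, hence so is kappa on J. *)
Definition is_spherical_curvature (J : set R) (l : R -> 'rV[R]_4)
    (kappa : R -> R) : Prop :=
  exists n : R -> 'rV[R]_4,
    [/\ smooth_on J n,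
        (forall v, J v -> E31_frame (l v) (derive1 l v) (n v)) &
        (forall v, J v -> kappa v = dotp (derive1n 2 l v) (n v))].

Record meridian_data (I J : set R) (f g : R -> R) (l : R -> 'rV[R]_4)
    : Prop := MeridianData {
  meridian_I : open_interval I;
  meridian_J : open_interval J;
  meridian_f_smooth : smooth_on I f;
  meridian_g_smooth : smooth_on I g;
  meridian_f_neq0 : forall u, I u -> f u != 0;
  meridian_unit_speed : forall u, I u -> derive1 f u ^+ 2 - derive1 g u ^+ 2 = 1;
  meridian_dg_neq0 : forall u, I u -> derive1 g u != 0;
  meridian_l_smooth : smooth_on J l;
  meridian_l_sphere : forall v, J v -> S21 (l v);
  meridian_l_timelike : forall v, J v -> dotp (derive1 l v) (derive1 l v) = -1
}.

Definition meridian_surface (f g : R -> R) (l : R -> 'rV[R]_4) :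
    R -> R -> 'rV[R]_4 :=
  fun u v => f u *: l v + g u *: ebasis 3.

End Surfaces.

(* Main.v *)
Require Import Defs.
From HB Require Import structures.
From mathcomp Require Import all_boot all_order all_algebra.
From mathcomp Require Import ring lra.
From mathcomp Require Import all_classical all_reals all_analysis.
Import Order.TTheory GRing.Theory Num.Theory.
Import numFieldNormedType.Exports.

(* In the frame (z_u, z_v / f) the mean curvature vector is
     2 f H = (f f'' + f'^2) l + (f g'' + f' g') e_4 - l''.
   Since <l'', l> = 1 and l'' lies in E31, H = 0 splits into l'' = l, which is
   kappa = 0, and f f'' + f'^2 = 1, f g'' + f' g' = 0.  The first equation says
   (f^2)'' = 2 and the second that k = f g' is constant; the unit speed condition
   gives k^2 = a^2 - b.  Conversely the unit speed condition turns the first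
   equation into the second, so only the formula for f is needed. *)

Set Implicit Arguments.
Unset Strict Implicit.
Unset Printing Implicit Defensive.

Local Open Scope classical_set_scope.
Local Open Scope ring_scope.

(** * Derivatives and constancy on open intervals *)

Section Calculus.
Context {R : realType}.
Implicit Types (I : set R) (f g : R -> R) (x y : R).

Lemma is_derive_mxP {m n} (M : R -> 'M[R]_(m, n)) x (dM : 'M[R]_(m, n)) :
  is_derive x 1 M dM <->
  (forall i j, is_derive x 1 (fun y => M y i j) (dM i j)).
Proof.
split=> [[Mx <-] i j|dMx].
  rewrite derive_mx// mxE; apply: DeriveDef => //.
  exact: (derivable_mxP M x 1).1.
have Mx : derivable M x 1.
  by apply: (derivable_mxP M x 1).2 => i j; case: (dMx i j).
apply: DeriveDef => //; rewrite derive_mx//; apply/matrixP => i j.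
by rewrite mxE; case: (dMx i j).
Qed.

Lemma is_derive_scalel {m n} f x df (A : 'M[R]_(m, n)) :
  is_derive x 1 f df -> is_derive x 1 (fun y => f y *: A) (df *: A).
Proof.
move=> dfx; apply/is_derive_mxP => i j.
rewrite (_ : (fun y => _) = A i j \*: f); last first.
  by apply/funext => y; rewrite mxE/= mulrC.
by apply: is_derive_eq; rewrite mxE mulrC.
Qed.

Lemma derive1P {V : normedModType R} (c : R -> V) x :
  derivable c x 1 -> is_derive x 1 c (derive1 c x).
Proof. by rewrite derive1E; exact: derivableP. Qed.

Lemma is_derive1E {V : normedModType R} {c : R -> V} {x dc} :
  is_derive x 1 c dc -> derive1 c x = dc.
Proof. by move=> cx; rewrite derive1E derive_val. Qed.

Lemma is_derive_on {V : normedModType R} {I} {c d : R -> V} {x dc} :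
  open I -> I x -> (forall y, I y -> c y = d y) ->
  is_derive x 1 c dc -> is_derive x 1 d dc.
Proof.
move=> oI Ix cd; apply: near_eq_is_derive.
by near=> y; apply: cd; near: y; exact: open_nbhs_nbhs.
Unshelve. all: by end_near. Qed.

(** Turns a constraint valid on [I] into an equation: [dc] is whatever expression the
    differentiation rules produce for the constrained quantity. *)
Lemma derive_cst_on {V : normedModType R} I (c : R -> V) a x dc :
  open I -> I x -> (forall y, I y -> c y = a) ->
  is_derive x 1 c dc -> dc = 0.
Proof.
move=> oI Ix ca /(is_derive_on (d := cst a) oI Ix ca) [_ <-].
exact: derive_cst.
Qed.

Lemma is_derive0_cst_on I f x y : is_interval I ->
  (forall t, I t -> is_derive t 1 f 0) -> I x -> I y -> f x = f y.
Proof.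
move=> itvI df0.
wlog xy : x y / x <= y => [H Ix Iy|Ix Iy].
  by case/orP: (le_total x y) => /H-> //.
have Ixy t : t \in `[x, y]%R -> I t by move=> /itvP txy; apply: (itvI x y); rewrite ?txy.
have [t txy||c _] := @MVT_segment _ f (fun=> 0) x y xy.
- by apply: df0; apply: Ixy; move: txy; rewrite !in_itv/= => /andP[/ltW-> /ltW->].
- by apply: derivable_within_continuous => t /Ixy/df0 [].
- by rewrite mul0r => /eqP; rewrite subr_eq0 => /eqP.
Qed.

Lemma is_derive_mul f g x df dg :
  is_derive x 1 f df -> is_derive x 1 g dg ->
  is_derive x 1 (fun y => f y * g y) (f x * dg + g x * df).
Proof. exact: is_deriveM. Qed.

Lemma is_derive_sqr f x df :
  is_derive x 1 f df -> is_derive x 1 (fun y => f y ^+ 2) (2 * f x * df).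
Proof.
by move=> dfx; apply: (is_derive_eq (is_derive_mul dfx dfx)); ring.
Qed.

Lemma is_derive_ln_norm f x df : f x != 0 ->
  is_derive x 1 f df -> is_derive x 1 (fun y => ln `|f y|) (df / f x).
Proof.
move=> fx0 dfx.
have f2 : 0 < (f ^+ 2) x by rewrite fctE exprn_even_gt0.
have dln := is_derive1_ln f2.
(* Writing [ln |f|] as half of [ln (f ^+ 2)] avoids a case split on the sign of [f]. The identity
   holds even at zeros of [f], because [ln 0 = 0] by convention. *)
have -> : (fun y => ln `|f y|) = 2^-1 \*: (@ln R \o f ^+ 2).
  apply/funext => y; rewrite /= !fctE.
  have [->|fy0] := eqVneq (f y) 0; first by rewrite normr0 expr0n /= !ln0// scaler0.
  by rewrite -real_normK ?num_real// lnXn ?normr_gt0// /GRing.scale/=; field.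
apply: is_derive_eq; rewrite /GRing.scale/= !fctE.
by field.
Qed.

(** Near a point where [f] is continuous and nonzero its sign is locally constant, so the sign
    function has derivative 0 on [I] and the mean value argument applies to it. *)
Lemma sgr_cst_on I f x y : is_interval I ->
  (forall t, I t -> f t != 0 /\ derivable f t 1) -> I x -> I y ->
  Num.sg (f x) = Num.sg (f y).
Proof.
move=> itvI fI; apply: (is_derive0_cst_on (f := Num.sg \o f) itvI) => // t /fI [ft0 dft].
have cf : {for t, continuous f}.
  exact/differentiable_continuous/derivable1_diffP.
apply: (near_eq_is_derive (f := cst (Num.sg (f t)))).
case/orP: (lt_total ft0) => f0.
- near=> s; rewrite /= !ltr0_sg//.
  by near: s; exact: cvgr_lt cf _ f0.
- near=> s; rewrite /= !gtr0_sg//.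
  by near: s; exact: cvgr_gt cf _ f0.
Unshelve. all: by end_near. Qed.

End Calculus.

(** * Algebra of the inner product and of the subspace [E31] *)

Section Dotp.
Context {R : realType}.
Implicit Types p q w : 'rV[R]_4.

Lemma dotpC p q : dotp p q = dotp q p.
Proof. by rewrite /dotp; ring. Qed.

Lemma dotpDl p q w : dotp (p + q) w = dotp p w + dotp q w.
Proof. by rewrite /dotp !mxE; ring. Qed.

Lemma dotpZl (a : R) p w : dotp (a *: p) w = a * dotp p w.
Proof. by rewrite /dotp !mxE; ring. Qed.

Lemma dotpNl p w : dotp (- p) w = - dotp p w.
Proof. by rewrite /dotp !mxE; ring. Qed.

Lemma dotpDr p q w : dotp w (p + q) = dotp w p + dotp w q.
Proof. by rewrite /dotp !mxE; ring. Qed.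

Lemma dotpZr (a : R) p w : dotp w (a *: p) = a * dotp w p.
Proof. by rewrite /dotp !mxE; ring. Qed.

Lemma dotp_comb (a b c d : R) p q :
  dotp (a *: p + b *: q) (c *: p + d *: q) =
  a * c * dotp p p + (a * d + b * c) * dotp p q + b * d * dotp q q.
Proof. by rewrite /dotp !mxE; ring. Qed.

Lemma row4P p q :
  [/\ p 0 0 = q 0 0, p 0 1 = q 0 1, p 0 2 = q 0 2 & p 0 3 = q 0 3] -> p = q.
Proof.
move=> [p0 p1 p2 p3]; apply/rowP => -[[|[|[|[|i]]]] ilt] //.
- by rewrite (_ : Ordinal _ = 0)//; exact: val_inj.
- by rewrite (_ : Ordinal _ = 1)//; exact: val_inj.
- by rewrite (_ : Ordinal _ = 2)//; exact: val_inj.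
- by rewrite (_ : Ordinal _ = 3)//; exact: val_inj.
Qed.

Lemma ebasisE (i j : 'I_4) : @ebasis R i 0 j = (j == i)%:R.
Proof. by rewrite mxE eqxx. Qed.

Lemma E31P p : E31 p <-> p 0 3 = 0.
Proof.
split=> [[a [b [c ->]]]|p3]; first by rewrite !mxE/=; ring.
exists (p 0 0), (p 0 1), (p 0 2).
by apply: row4P; split; rewrite !mxE/= ?p3; ring.
Qed.

Lemma dotp_e4 p : dotp p (ebasis 3) = - p 0 3.
Proof. by rewrite /dotp !ebasisE/=; ring. Qed.

Lemma dotp_e4e4 : dotp (ebasis 3) (ebasis 3) = -1 :> R.
Proof. by rewrite dotp_e4 ebasisE. Qed.

Lemma is_derive_dotp (p q : R -> 'rV[R]_4) (v : R) dp dq :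
  is_derive v 1 p dp -> is_derive v 1 q dq ->
  is_derive v 1 (fun t => dotp (p t) (q t)) (dotp dp (q v) + dotp (p v) dq).
Proof.
move=> /is_derive_mxP dpv /is_derive_mxP dqv.
have d i := is_derive_mul (dpv 0 i) (dqv 0 i).
have D := is_deriveB (is_deriveB (is_deriveD (d 0) (d 1)) (d 2)) (d 3).
by apply: (is_derive_eq D); rewrite /dotp; ring.
Qed.

Lemma scale_unit_add (a b : R) p q : a = 1 -> b = 0 -> a *: p + b *: q = p.
Proof. by move=> -> ->; rewrite scale1r scale0r addr0. Qed.

(** The last coordinate gives [b = 0], and pairing with [p] gives [a = 1]. With [p = l] and
    [q = l''] this splits the equation H = 0. *)
Lemma E31_add_e4 (a b : R) p q : E31 p -> E31 q ->
  dotp p p = 1 -> dotp q p = 1 -> q = a *: p + b *: ebasis 3 ->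
  a = 1 /\ b = 0.
Proof.
move=> /E31P p3 /E31P q3 pp qp qE.
have b0 : b = 0 by move: q3; rewrite qE !mxE p3/= => <-; ring.
by split=> //; rewrite -qp qE b0 scale0r addr0 dotpZl pp mulr1.
Qed.

(** The Lorentzian cross product; the minus sign on the third component makes it orthogonal to both
    factors for [dotp]. *)
Definition cross31 p q : 'rV[R]_4 :=
  (p 0 1 * q 0 2 - p 0 2 * q 0 1) *: ebasis 0
  + (p 0 2 * q 0 0 - p 0 0 * q 0 2) *: ebasis 1
  - (p 0 0 * q 0 1 - p 0 1 * q 0 0) *: ebasis 2.

Lemma cross31E p q :
  [/\ cross31 p q 0 0 = p 0 1 * q 0 2 - p 0 2 * q 0 1,
      cross31 p q 0 1 = p 0 2 * q 0 0 - p 0 0 * q 0 2,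
      cross31 p q 0 2 = - (p 0 0 * q 0 1 - p 0 1 * q 0 0)
    & cross31 p q 0 3 = 0].
Proof. by rewrite /cross31 !mxE/=; split; ring. Qed.

Lemma cross31_eq p q p' q' :
  (forall i j, p 0 i * q 0 j - p 0 j * q 0 i =
               p' 0 i * q' 0 j - p' 0 j * q' 0 i) ->
  cross31 p q = cross31 p' q'.
Proof. by move=> pq; rewrite /cross31 (pq 1) (pq 2) (pq 0). Qed.

Lemma cross31_frame p q : E31 p -> E31 q ->
  dotp p p = 1 -> dotp q q = -1 -> dotp p q = 0 ->
  E31_frame p q (cross31 p q).
Proof.
have [c0 c1 c2 c3] := cross31E p q.
move=> Ep Eq pp qq pq; move: (Ep) (Eq) => /E31P p3 /E31P q3.
split; first by split=> //; exact/E31P.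
split; split=> //; rewrite /dotp c0 c1 c2 c3; try by ring.
(* Lagrange's identity in signature (2,1): the square of the cross product is
   [<p,q>^2 - <p,p><q,q>], which is 1 here. *)
have -> : forall x0 x1 x2 y0 y1 y2 : R,
  (x1 * y2 - x2 * y1) * (x1 * y2 - x2 * y1)
  + (x2 * y0 - x0 * y2) * (x2 * y0 - x0 * y2)
  - - (x0 * y1 - x1 * y0) * - (x0 * y1 - x1 * y0) - 0 * 0 =
  (x0 * y0 + x1 * y1 - x2 * y2) ^+ 2
  - (x0 * x0 + x1 * x1 - x2 * x2) * (y0 * y0 + y1 * y1 - y2 * y2).
  by move=> *; ring.
move: pp qq pq; rewrite /dotp p3 q3 !mulr0 !subr0 => -> -> ->.
by ring.
Qed.

(** The coordinate determinant [D] of the frame is nonzero, so the three orthogonality conditions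
    form a homogeneous linear system with only the zero solution. *)
Lemma E31_frame_eq0 p q w z : E31_frame p q w -> E31 z ->
  dotp z p = 0 -> dotp z q = 0 -> dotp z w = 0 -> z = 0.
Proof.
move=> [[/E31P p3 /E31P q3 /E31P w3] [[pp qq ww] [pq pw qw]]] /E31P z3.
move: pp qq ww pq pw qw; rewrite /dotp z3 p3 q3 w3 !mul0r !subr0.
move: (p 0 0) (p 0 1) (p 0 2) (q 0 0) (q 0 1) (q 0 2) (w 0 0) (w 0 1) (w 0 2).
move=> p0 p1 p2 q0 q1 q2 w0 w1 w2 pp qq ww pq pw qw zp zq zw.
pose D := p0 * (q1 * w2 - q2 * w1) - p1 * (q0 * w2 - q2 * w0)
          + p2 * (q0 * w1 - q1 * w0).
(* D^2 is minus the Gram determinant of (p, q, w). *)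
have D2 : D ^+ 2 = 1.
  pose dot3 (a0 a1 a2 b0 b1 b2 : R) := a0 * b0 + a1 * b1 - a2 * b2.
  have -> : D ^+ 2 = - (
     dot3 p0 p1 p2 p0 p1 p2 *
       (dot3 q0 q1 q2 q0 q1 q2 * dot3 w0 w1 w2 w0 w1 w2
        - dot3 q0 q1 q2 w0 w1 w2 ^+ 2)
     - dot3 p0 p1 p2 q0 q1 q2 *
       (dot3 p0 p1 p2 q0 q1 q2 * dot3 w0 w1 w2 w0 w1 w2
        - dot3 q0 q1 q2 w0 w1 w2 * dot3 p0 p1 p2 w0 w1 w2)
     + dot3 p0 p1 p2 w0 w1 w2 *
       (dot3 p0 p1 p2 q0 q1 q2 * dot3 q0 q1 q2 w0 w1 w2
        - dot3 q0 q1 q2 q0 q1 q2 * dot3 p0 p1 p2 w0 w1 w2)).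
    by rewrite /D /dot3; ring.
  by rewrite /dot3 pp qq ww pq pw qw; ring.
have D0 : D != 0 by apply: contra_eq_neq D2 => ->; rewrite expr0n/= eq_sym oner_eq0.
have cramer (x : R) : D * x = 0 -> x = 0.
  by move/eqP; rewrite mulf_eq0 (negPf D0) => /eqP.
apply: row4P; split; rewrite !mxE//; apply: cramer.
(* Cramer's rule: [D] times each coordinate of [z] is a combination, with cofactors as coefficients,
   of its products with [p], [q], [w]. *)
- transitivity ((z 0 0 * p0 + z 0 1 * p1 - z 0 2 * p2) * (q1 * w2 - q2 * w1)
    - (z 0 0 * q0 + z 0 1 * q1 - z 0 2 * q2) * (p1 * w2 - p2 * w1)
    + (z 0 0 * w0 + z 0 1 * w1 - z 0 2 * w2) * (p1 * q2 - p2 * q1)).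
    by rewrite /D; ring.
  by rewrite zp zq zw; ring.
- transitivity (- (z 0 0 * p0 + z 0 1 * p1 - z 0 2 * p2) * (q0 * w2 - q2 * w0)
    + (z 0 0 * q0 + z 0 1 * q1 - z 0 2 * q2) * (p0 * w2 - p2 * w0)
    - (z 0 0 * w0 + z 0 1 * w1 - z 0 2 * w2) * (p0 * q2 - p2 * q0)).
    by rewrite /D; ring.
  by rewrite zp zq zw; ring.
- transitivity (- (z 0 0 * p0 + z 0 1 * p1 - z 0 2 * p2) * (q0 * w1 - q1 * w0)
    + (z 0 0 * q0 + z 0 1 * q1 - z 0 2 * q2) * (p0 * w1 - p1 * w0)
    - (z 0 0 * w0 + z 0 1 * w1 - z 0 2 * w2) * (p0 * q1 - p1 * q0)).
    by rewrite /D; ring.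
  by rewrite zp zq zw; ring.
Qed.

End Dotp.

(** * Linearity of the normal projection *)

Section NormalPart.
Context {R : realType}.
Implicit Types p q w : 'rV[R]_4.

Lemma normal_partB p q w1 w2 :
  normal_part p q w1 - normal_part p q w2 = normal_part p q (w1 - w2).
Proof.
rewrite /normal_part !dotpDl !dotpNl; apply/rowP => i; rewrite !mxE.
by ring.
Qed.

Lemma normal_part_quadB p q w11 w12 w22 (x y : R * R) :
  normal_part p q ((x.1 * x.1) *: w11 + (x.1 * x.2 + x.2 * x.1) *: w12
    + (x.2 * x.2) *: w22)
  - normal_part p q ((y.1 * y.1) *: w11 + (y.1 * y.2 + y.2 * y.1) *: w12
    + (y.2 * y.2) *: w22) =
  normal_part p q ((x.1 * x.1 - y.1 * y.1) *: w11
    + (2 * (x.1 * x.2 - y.1 * y.2)) *: w12 + (x.2 * x.2 - y.2 * y.2) *: w22).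
Proof.
rewrite normal_partB; congr normal_part.
by apply/rowP => i; rewrite !mxE; ring.
Qed.

(** Removes the mixed derivative from the trace of h: on a meridian surface [z_uv] is parallel to
    [z_v]. *)
Lemma normal_partDr p q w (c : R) : gram_det p q != 0 ->
  normal_part p q (w + c *: q) = normal_part p q w.
Proof.
rewrite /gram_det => W0.
rewrite /normal_part !dotpDl !dotpZl (dotpC q p) /gram_det.
apply/rowP => i; rewrite !mxE.
move: (dotp p p) (dotp p q) (dotp q q) W0 => E F G W0.
by field.
Qed.

End NormalPart.

Section Smooth.
Context {R : realType} {V : normedModType R}.

Lemma smooth_derive {I : set R} {c : R -> V} {x} : smooth_on I c -> I x ->
  is_derive x 1 c (derive1 c x).
Proof. by move=> /(_ 0%N x) + Ix => /(_ Ix); exact: derive1P. Qed.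

Lemma smooth_derive2 {I : set R} {c : R -> V} {x} : smooth_on I c -> I x ->
  is_derive x 1 (derive1 c) (derive1n 2 c x).
Proof. by move=> /(_ 1%N x) + Ix => /(_ Ix); exact: derive1P. Qed.

End Smooth.

(** * Pointwise algebra, with [a], [a'], [a''] for f and its derivatives, [b'], [b''] for those of
    g *)

Section MeridianPoint.
Context {R : realType} (a a' a'' b' b'' : R) (l l' l'' : 'rV[R]_4).
Hypotheses (a0 : a != 0) (speed : a' ^+ 2 - b' ^+ 2 = 1)
  (speed' : a' * a'' = b' * b'').
Hypotheses (El : E31 l) (El' : E31 l') (El'' : E31 l'').
Hypotheses (ll : dotp l l = 1) (l'l' : dotp l' l' = -1) (ll' : dotp l l' = 0)
  (l''l : dotp l'' l = 1) (l''l' : dotp l'' l' = 0).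

Let dotp_e4E31 (p : 'rV[R]_4) : E31 p -> dotp p (ebasis 3) = 0.
Proof. by rewrite dotp_e4 => /E31P ->; rewrite oppr0. Qed.

Let dotpE := (@dotpDl R, @dotpDr R, @dotpZl R, @dotpZr R, @dotpNl R,
  @dotp_e4e4 R, dotpC (@ebasis R 3), dotp_e4E31 El, dotp_e4E31 El',
  dotp_e4E31 El'', dotpC l' l, ll, ll', l'l', l''l, l''l').

Let p := a' *: l + b' *: ebasis 3.
Let q := a *: l'.

Lemma meridian_dotp_uu : dotp p p = 1.
Proof. by rewrite /p !dotpE -[RHS]speed; ring. Qed.

Lemma meridian_dotp_uv : dotp p q = 0.
Proof. by rewrite /p /q !dotpE; ring. Qed.

Lemma meridian_dotp_vv : dotp q q = - a ^+ 2.
Proof. by rewrite /q !dotpE; ring. Qed.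

Lemma meridian_gram : gram_det p q = - a ^+ 2.
Proof.
by rewrite /gram_det meridian_dotp_uu meridian_dotp_vv meridian_dotp_uv; ring.
Qed.

Lemma meridian_dotp_tangent (x1 x2 y1 y2 : R) :
  dotp (x1 *: p + x2 *: q) (y1 *: p + y2 *: q) = x1 * y1 - a ^+ 2 * (x2 * y2).
Proof.
by rewrite dotp_comb meridian_dotp_uu meridian_dotp_vv meridian_dotp_uv; ring.
Qed.

(** Once the multiple of [q] is dropped, the remaining vector [w] is orthogonal to [q] and satisfies
    [<w,p> = - a'/a], so its normal part is [w + (a'/a) p]. *)
Lemma meridian_normal_part (c : R) :
  normal_part p q (a'' *: l + b'' *: ebasis 3 - a^-1 *: l'' + c *: q) =
  a^-1 *: ((a * a'' + a' ^+ 2) *: l + (a * b'' + a' * b') *: ebasis 3 - l'').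
Proof.
rewrite normal_partDr; last by rewrite meridian_gram oppr_eq0 expf_neq0.
set w := _ - _.
have wp : dotp w p = - (a' / a).
  transitivity (a' * a'' - b' * b'' - a' / a); last by rewrite speed'; ring.
  by rewrite /w /p !dotpE; ring.
have wq : dotp w q = 0 by rewrite /w /q !dotpE; ring.
rewrite /normal_part wp wq meridian_gram meridian_dotp_uu meridian_dotp_vv.
rewrite meridian_dotp_uv /w /p /q.
by apply/rowP => i; rewrite !mxE; field.
Qed.

End MeridianPoint.

(* The coordinate matrix of an orthonormal frame also satisfies the dual
   orthonormality relations. *)
Lemma lorentz_frame_dual {R : realType} (F x1 x2 y1 y2 : R) : F != 0 ->
  x1 * x1 - F * (x2 * x2) = 1 -> y1 * y1 - F * (y2 * y2) = -1 ->
  x1 * y1 - F * (x2 * y2) = 0 ->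
  x1 * x1 - y1 * y1 = 1 /\ x2 * x2 - y2 * y2 = - F^-1.
Proof.
move=> F0 xx yy xy.
have F22 : F * (y2 * y2 - x2 * x2) = 1.
  (* Substituting the three relations leaves only [A = F x2^2] and [B = F y2^2], with
     [A B = (1 + A)(B - 1)], that is [B - A = 1]. *)
  have : (x1 * y1) * (x1 * y1) = (x1 * x1) * (y1 * y1) by ring.
  have -> : x1 * y1 = F * (x2 * y2) by lra.
  have -> : x1 * x1 = 1 + F * (x2 * x2) by lra.
  have -> : y1 * y1 = F * (y2 * y2) - 1 by lra.
  by move=> H; lra.
split; first lra.
by apply: (mulfI F0); rewrite mulrN divff// -F22; ring.
Qed.

(** * Partial derivatives and mean curvature of a meridian surface *)

Section Meridian.
Context {R : realType} (I J : set R) (f g : R -> R) (l : R -> 'rV[R]_4).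
Hypothesis mer : meridian_data I J f g l.

Let z := meridian_surface f g l.

Let openI : open I. Proof. by case: (meridian_I mer). Qed.
Let openJ : open J. Proof. by case: (meridian_J mer). Qed.

Lemma meridian_partial_u u v : I u ->
  partial_u z u v = derive1 f u *: l v + derive1 g u *: ebasis 3.
Proof.
move=> Iu; have df := smooth_derive (meridian_f_smooth mer) Iu.
have dg := smooth_derive (meridian_g_smooth mer) Iu.
have D := is_deriveD (is_derive_scalel (l v) df)
  (is_derive_scalel (ebasis 3) dg).
exact: (is_derive1E D).
Qed.

Lemma meridian_partial_v u v : J v -> partial_v z u v = f u *: derive1 l v.
Proof.
move=> Jv; have dl := smooth_derive (meridian_l_smooth mer) Jv.
have D := is_deriveD (is_deriveZ (f u) dl)
  (is_derive_cst (g u *: ebasis 3) v 1).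
by rewrite -[RHS]addr0; exact: (is_derive1E D).
Qed.

Lemma meridian_partial_uu u v : I u -> partial_u (partial_u z) u v =
  derive1n 2 f u *: l v + derive1n 2 g u *: ebasis 3.
Proof.
move=> Iu; have df := smooth_derive2 (meridian_f_smooth mer) Iu.
have dg := smooth_derive2 (meridian_g_smooth mer) Iu.
apply: is_derive1E; apply: (is_derive_on openI Iu).
  by move=> t It; exact/esym/meridian_partial_u.
exact: (is_deriveD (is_derive_scalel (l v) df)
  (is_derive_scalel (ebasis 3) dg)).
Qed.

Lemma meridian_partial_vu u v : I u -> J v ->
  partial_v (partial_u z) u v = derive1 f u *: derive1 l v.
Proof.
move=> Iu Jv; have dl := smooth_derive (meridian_l_smooth mer) Jv.
apply: is_derive1E; rewrite -[_ *: _]addr0.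
(* The formula for [z_u] holds for every value of the second variable, so a global equality of
   functions suffices. *)
rewrite (_ : partial_u z u = fun t => derive1 f u *: l t + derive1 g u *: ebasis 3).
  exact: (is_deriveD (is_deriveZ (derive1 f u) dl)
    (is_derive_cst (derive1 g u *: ebasis 3) v 1)).
by apply/funext => t; exact: meridian_partial_u.
Qed.

Lemma meridian_partial_vv u v : J v ->
  partial_v (partial_v z) u v = f u *: derive1n 2 l v.
Proof.
move=> Jv; have dl := smooth_derive2 (meridian_l_smooth mer) Jv.
apply: is_derive1E; apply: (is_derive_on openJ Jv _ (is_deriveZ (f u) dl)).
by move=> t Jt; exact/esym/meridian_partial_v.
Qed.

Lemma sphere_dotp_ll v : J v -> dotp (l v) (l v) = 1.
Proof. by move=> /(meridian_l_sphere mer) []. Qed.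

(** The products among l, l', l'' come from differentiating in turn [<l,l> = 1], [<l,l'> = 0] and
    [<l',l'> = -1]. *)
Lemma sphere_dotp_ll' v : J v -> dotp (l v) (derive1 l v) = 0.
Proof.
move=> Jv; have dl := smooth_derive (meridian_l_smooth mer) Jv.
have := derive_cst_on openJ Jv sphere_dotp_ll (is_derive_dotp dl dl).
by rewrite dotpC; lra.
Qed.

Lemma sphere_dotp_l''l v : J v -> dotp (derive1n 2 l v) (l v) = 1.
Proof.
move=> Jv; have dl := smooth_derive (meridian_l_smooth mer) Jv.
have ddl := smooth_derive2 (meridian_l_smooth mer) Jv.
have := derive_cst_on openJ Jv sphere_dotp_ll' (is_derive_dotp dl ddl).
by rewrite (meridian_l_timelike mer)// dotpC; lra.
Qed.

Lemma sphere_dotp_l''l' v : J v -> dotp (derive1n 2 l v) (derive1 l v) = 0.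
Proof.
move=> Jv; have ddl := smooth_derive2 (meridian_l_smooth mer) Jv.
have := derive_cst_on openJ Jv (meridian_l_timelike mer)
  (is_derive_dotp ddl ddl).
by rewrite [in X in _ + X]dotpC; lra.
Qed.

Lemma E31_derive (c : R -> 'rV[R]_4) v dc : (forall t, J t -> E31 (c t)) ->
  J v -> is_derive v 1 c dc -> E31 dc.
Proof.
move=> cE Jv /is_derive_mxP dcv; apply/E31P.
apply: (derive_cst_on (a := 0) openJ Jv _ (dcv 0 3)) => t /cE.
by move/E31P.
Qed.

Lemma sphere_E31 v : J v -> E31 (l v).
Proof. by move=> /(meridian_l_sphere mer) []. Qed.

Lemma sphere_E31' v : J v -> E31 (derive1 l v).
Proof.
move=> Jv; apply: (E31_derive sphere_E31 Jv).
exact: smooth_derive (meridian_l_smooth mer) Jv.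
Qed.

Lemma sphere_E31'' v : J v -> E31 (derive1n 2 l v).
Proof.
move=> Jv; apply: (E31_derive sphere_E31' Jv).
exact: smooth_derive2 (meridian_l_smooth mer) Jv.
Qed.

Lemma meridian_speed_derive u : I u ->
  derive1 f u * derive1n 2 f u = derive1 g u * derive1n 2 g u.
Proof.
move=> Iu; have ddf := smooth_derive2 (meridian_f_smooth mer) Iu.
have ddg := smooth_derive2 (meridian_g_smooth mer) Iu.
have := derive_cst_on openI Iu (meridian_unit_speed mer)
  (is_deriveB (is_derive_sqr ddf) (is_derive_sqr ddg)).
move: (derive1 f u) (derive1n 2 f u) (derive1 g u) (derive1n 2 g u) => a b c d.
by rewrite -!mulrA -mulrBr => /eqP; rewrite mulf_eq0 pnatr_eq0/= subr_eq0 => /eqP.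
Qed.

Section Point.
Variables (u v : R).
Hypotheses (Iu : I u) (Jv : J v).

Let f0 : f u != 0 := meridian_f_neq0 mer Iu.

Lemma meridian_tangent x : tangent z u v x =
  x.1 *: (derive1 f u *: l v + derive1 g u *: ebasis 3)
  + x.2 *: (f u *: derive1 l v).
Proof. by rewrite /tangent meridian_partial_u// meridian_partial_v. Qed.

Let dotp_tangent x y : dotp (tangent z u v x) (tangent z u v y) =
  x.1 * y.1 - f u ^+ 2 * (x.2 * y.2).
Proof.
rewrite !meridian_tangent; apply: meridian_dotp_tangent.
- exact: (meridian_unit_speed mer).
- exact: sphere_E31.
- exact: sphere_E31'.
- exact: sphere_dotp_ll.
- exact: (meridian_l_timelike mer).
- exact: sphere_dotp_ll'.
Qed.

Lemma meridian_lorentz_frame : lorentz_frame z u v (1, 0) (0, (f u)^-1).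
Proof. by split; rewrite dotp_tangent/=; field. Qed.

(** The trace does not depend on the frame: duality fixes the coefficients of [z_uu] and [z_vv] as
    [1] and [- 1/f^2], and the frame-dependent mixed term is tangent. *)
Lemma meridian_second_formB x y : lorentz_frame z u v x y ->
  second_form z u v x x - second_form z u v y y =
  (f u)^-1 *: ((f u * derive1n 2 f u + derive1 f u ^+ 2) *: l v
    + (f u * derive1n 2 g u + derive1 f u * derive1 g u) *: ebasis 3
    - derive1n 2 l v).
Proof.
move=> [+ + +]; rewrite !dotp_tangent => xx yy xy.
have [E11 E22] := lorentz_frame_dual (expf_neq0 2 f0) xx yy xy.
rewrite /second_form normal_part_quadB E11 E22 scale1r.
rewrite (meridian_partial_uu v Iu) (meridian_partial_vv u Jv).
rewrite (meridian_partial_vu Iu Jv) (meridian_partial_u v Iu).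
rewrite (meridian_partial_v u Jv).
have -> (c d : R) (w w1 w2 : 'rV[R]_4) :
    w + c *: (d *: w1) + - f u ^- 2 *: (f u *: w2) =
    w - (f u)^-1 *: w2 + (c * d / f u) *: (f u *: w1).
  by apply/rowP => i; rewrite !mxE; field.
apply: (meridian_normal_part f0 (meridian_unit_speed mer Iu)
  (meridian_speed_derive Iu) (sphere_E31 Jv) (sphere_E31' Jv) (sphere_E31'' Jv)
  (sphere_dotp_ll Jv) (meridian_l_timelike mer Jv) (sphere_dotp_ll' Jv)
  (sphere_dotp_l''l Jv) (sphere_dotp_l''l' Jv)).
Qed.

Lemma meridian_mean_curvature0 : is_mean_curvature_vector z u v 0 <->
  derive1n 2 l v = (f u * derive1n 2 f u + derive1 f u ^+ 2) *: l v
    + (f u * derive1n 2 g u + derive1 f u * derive1 g u) *: ebasis 3.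
Proof.
split=> [[_ /(_ _ _ meridian_lorentz_frame)]|l''E].
  rewrite (meridian_second_formB meridian_lorentz_frame) => /esym/eqP.
  rewrite !scaler_eq0 !invr_eq0 (negPf f0) pnatr_eq0/= subr_eq0.
  by move=> /eqP.
split; first by exists (1, 0), (0, (f u)^-1); exact: meridian_lorentz_frame.
by move=> x y /meridian_second_formB ->; rewrite -l''E subrr !scaler0.
Qed.

End Point.

End Meridian.

Lemma smooth_on_cst {R : realType} {V : normedModType R} (I : set R) (a : V) :
  smooth_on I (cst a).
Proof.
move=> n x _; suff [b ->] : exists b : V, derive1n n (cst a) = cst b.
  exact: derivable_cst.
elim: n => [|n [b IHn]]; first by exists a.
by exists 0; rewrite derive1nS IHn; apply/funext => y; rewrite derive1_cst.
Qed.

(** * Reduction of minimality to differential equations, and their solution *)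

Section MeridianMinimal.
Context {R : realType} (I J : set R) (f g : R -> R) (l : R -> 'rV[R]_4).
Hypothesis mer : meridian_data I J f g l.

Let openI : open I. Proof. by case: (meridian_I mer). Qed.
Let itvI : is_interval I. Proof. by case: (meridian_I mer). Qed.
Let itvJ : is_interval J. Proof. by case: (meridian_J mer). Qed.

Let df u (Iu : I u) := smooth_derive (meridian_f_smooth mer) Iu.
Let dg u (Iu : I u) := smooth_derive (meridian_g_smooth mer) Iu.
Let ddf u (Iu : I u) := smooth_derive2 (meridian_f_smooth mer) Iu.
Let ddg u (Iu : I u) := smooth_derive2 (meridian_g_smooth mer) Iu.

(** If kappa is 0, then [l'' - l] is orthogonal to the whole frame. Conversely a normal field must
    be built; the cross product of l and l' serves, and [l'' = l] makes it constant. *)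
Lemma spherical_curvature0P : is_spherical_curvature J l (fun=> 0) <->
  forall v, J v -> derive1n 2 l v = l v.
Proof.
split=> [[n [_ nE kE]] v Jv|l''E].
  have [_ [[ll _ _] [_ ln _]]] := nE v Jv.
  apply/eqP; rewrite -subr_eq0; apply/eqP.
  apply: (E31_frame_eq0 (nE v Jv)).
  - apply/E31P; rewrite !mxE (E31P _).1 ?(E31P _).1 ?subrr//.
      exact: (sphere_E31 mer).
    exact: (sphere_E31'' mer).
  - by rewrite dotpDl dotpNl (sphere_dotp_l''l mer Jv) ll subrr.
  - rewrite dotpDl dotpNl (sphere_dotp_l''l' mer Jv).
    by rewrite (sphere_dotp_ll' mer Jv) subrr.
  - by rewrite dotpDl dotpNl -kE// ln subrr.
have [_ _ [v0 Jv0]] := meridian_J mer.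
pose n v := cross31 (l v) (derive1 l v).
(* The minors of [(l, l')] have as derivatives those of [(l, l'')], which vanish when [l'' = l]. *)
have minor0 v i j : J v -> is_derive v 1
    (fun t => l t 0 i * derive1 l t 0 j - l t 0 j * derive1 l t 0 i) 0.
  move=> Jv.
  have /is_derive_mxP dl := smooth_derive (meridian_l_smooth mer) Jv.
  have /is_derive_mxP ddl := smooth_derive2 (meridian_l_smooth mer) Jv.
  apply: (is_derive_eq (is_deriveB (is_derive_mul (dl 0 i) (ddl 0 j))
    (is_derive_mul (dl 0 j) (ddl 0 i)))).
  by rewrite l''E//; ring.
have n_cst v : J v -> n v = n v0.
  move=> Jv; have m i j : l v 0 i * derive1 l v 0 j - l v 0 j * derive1 l v 0 i =
      l v0 0 i * derive1 l v0 0 j - l v0 0 j * derive1 l v0 0 i.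
    exact: (is_derive0_cst_on itvJ (fun t Jt => minor0 t i j Jt) Jv Jv0).
  exact: (cross31_eq m).
have nE v : J v -> E31_frame (l v) (derive1 l v) (n v0).
  move=> Jv; rewrite -(n_cst v Jv); apply: cross31_frame.
  - exact: (sphere_E31 mer).
  - exact: (sphere_E31' mer).
  - exact: (sphere_dotp_ll mer).
  - exact: (meridian_l_timelike mer).
  - exact: (sphere_dotp_ll' mer).
exists (cst (n v0)); split=> [|//|v Jv]; first exact: smooth_on_cst.
by rewrite l''E//; have [_ [_ [_ -> _]]] := nE v Jv.
Qed.

Lemma meridian_minimalP : minimal_surface I J (meridian_surface f g l) <->
  (forall v, J v -> derive1n 2 l v = l v) /\
  (forall u, I u -> f u * derive1n 2 f u + derive1 f u ^+ 2 = 1 /\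
                    f u * derive1n 2 g u + derive1 f u * derive1 g u = 0).
Proof.
split=> [minz|[l''E ode] u v Iu Jv]; last first.
  apply/(meridian_mean_curvature0 mer Iu Jv)/esym.
  have [A1 B0] := ode u Iu; rewrite l''E//.
  exact: scale_unit_add A1 B0.
have l''E u v (Iu : I u) (Jv : J v) :=
  (meridian_mean_curvature0 mer Iu Jv).1 (minz u v Iu Jv).
have ode u v : I u -> J v ->
    f u * derive1n 2 f u + derive1 f u ^+ 2 = 1 /\
    f u * derive1n 2 g u + derive1 f u * derive1 g u = 0.
  move=> Iu Jv; apply: (E31_add_e4 (sphere_E31 mer Jv) (sphere_E31'' mer Jv)).
  - exact: (sphere_dotp_ll mer).
  - exact: (sphere_dotp_l''l mer).
  - exact: l''E.
(* Separation of variables: one point of [J] yields the equations on all of [I], and one point of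
   [I] yields [l'' = l] on all of [J]. *)
have [_ _ [u0 Iu0]] := meridian_I mer; have [_ _ [v0 Jv0]] := meridian_J mer.
split=> [v Jv|u Iu]; last exact: ode Iu Jv0.
have [A1 B0] := ode u0 v Iu0 Jv.
exact: etrans (l''E u0 v Iu0 Jv) (scale_unit_add _ _ A1 B0).
Qed.

(** Three first integrals, [f f' - u = a], [f^2 - u^2 - 2 a u = b] and [f g' = k], with their values
    read off at a base point [u0]; then [g' = k / f] is integrated. *)
Lemma meridian_ode_solution :
  (forall u, I u -> f u * derive1n 2 f u + derive1 f u ^+ 2 = 1 /\
                    f u * derive1n 2 g u + derive1 f u * derive1 g u = 0) ->
  exists (a b C : R) (s1 s2 : bool),
    0 < a ^+ 2 - b /\
    forall u : R, I u ->
      f u = (-1) ^+ s1 * Num.sqrt (u ^+ 2 + 2 * a * u + b) /\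
      g u = (-1) ^+ s2 * Num.sqrt (a ^+ 2 - b)
              * ln `|u + a + Num.sqrt (u ^+ 2 + 2 * a * u + b)| + C.
Proof.
move=> ode; have [_ _ [u0 Iu0]] := meridian_I mer.
pose a := f u0 * derive1 f u0 - u0.
have ff' u : I u -> f u * derive1 f u = u + a.
  move=> Iu; rewrite /a.
  have -> : f u0 * derive1 f u0 - u0 = f u * derive1 f u - u.
    apply: (is_derive0_cst_on (f := fun t => f t * derive1 f t - t) itvI _ Iu0 Iu).
    move=> t It; have [ode1 _] := ode t It.
    apply: (is_derive_eq (is_deriveB (is_derive_mul (df It) (ddf It))
      (is_derive_id t 1))).
    by rewrite -expr2 ode1 subrr.
  by ring.
pose b := f u0 ^+ 2 - u0 ^+ 2 - 2 * a * u0.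
have f2 u : I u -> f u ^+ 2 = u ^+ 2 + 2 * a * u + b.
  move=> Iu; rewrite /b.
  have -> : f u0 ^+ 2 - u0 ^+ 2 - 2 * a * u0 = f u ^+ 2 - u ^+ 2 - 2 * a * u.
    apply: (is_derive0_cst_on (f := fun t => f t ^+ 2 - t ^+ 2 - 2 * a * t) itvI _ Iu0 Iu).
    move=> t It.
    apply: (is_derive_eq (is_deriveB (is_deriveB (is_derive_sqr (df It))
      (is_derive_sqr (is_derive_id t 1)))
      (is_derive_mul (is_derive_cst (2 * a) t 1) (is_derive_id t 1)))).
    by rewrite -mulrA ff'//=; ring.
  by ring.
pose k := f u0 * derive1 g u0.
have fg' u : I u -> f u * derive1 g u = k.
  move=> Iu; apply: (is_derive0_cst_on (f := fun t => f t * derive1 g t) itvI _ Iu Iu0).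
  move=> t It; have [_ ode2] := ode t It.
  apply: (is_derive_eq (is_derive_mul (df It) (ddg It))).
  by rewrite [derive1 g t * _]mulrC.
have k0 : k != 0.
  by rewrite mulf_neq0 ?(meridian_f_neq0 mer)// (meridian_dg_neq0 mer).
have k2 : k ^+ 2 = a ^+ 2 - b.
  (* By unit speed, [k^2 = (f f')^2 - f^2], which is [(u0 + a)^2 - (u0^2 + 2 a u0 + b)]. *)
  transitivity ((f u0 * derive1 f u0) ^+ 2
    - f u0 ^+ 2 * (derive1 f u0 ^+ 2 - derive1 g u0 ^+ 2)).
    by rewrite /k; ring.
  by rewrite (meridian_unit_speed mer)// ff'// f2//; ring.
(* The sign of [f], constant on [I] because [f] never vanishes there. *)
pose s : R := (-1) ^+ (f u0 < 0)%R.
have ss : s * s = 1 by rewrite /s -expr2 sqrr_sign.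
have fs u : I u -> f u = s * Num.sqrt (u ^+ 2 + 2 * a * u + b).
  move=> Iu; rewrite -f2// sqrtr_sqr {1}[f u]numEsign /s.
  have fI t : I t -> f t != 0 /\ derivable f t 1.
    by move=> It; split; [exact: (meridian_f_neq0 mer)|case: (df It)].
  by rewrite -[in LHS]sgr_lt0 -[in RHS]sgr_lt0 (sgr_cst_on itvI fI Iu Iu0).
have sqrtE u : I u -> Num.sqrt (u ^+ 2 + 2 * a * u + b) = s * f u.
  by move=> Iu; rewrite fs// mulrA ss mul1r.
pose h t := g t - k * s * ln `|t + a + s * f t|.
(* [C] is the constant value of [h]. The second sign is that of [k s], since [|k|] is the square
   root of [a^2 - b]. *)
exists a, b, (h u0), (f u0 < 0)%R, ((k < 0) (+) (f u0 < 0))%R.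
split; first by rewrite -k2 exprn_even_gt0.
move=> u Iu; split; first exact: fs.
have -> : (-1) ^+ ((k < 0) (+) (f u0 < 0))%R * Num.sqrt (a ^+ 2 - b) = k * s.
  by rewrite -k2 sqrtr_sqr signr_addb mulrAC -numEsign.
rewrite sqrtE//.
suff -> : h u0 = h u by rewrite /h; ring.
apply: (is_derive0_cst_on itvI _ Iu0 Iu) => t It.
have ft0 := meridian_f_neq0 mer It.
(* Otherwise [f'^2 = 1], and unit speed would force [g' = 0]. *)
have w0 : derive1 f t + s != 0.
  apply: contra_neq (meridian_dg_neq0 mer It) => w0.
  apply/eqP; rewrite -sqrf_eq0; apply/eqP.
  transitivity ((derive1 f t + s) * (derive1 f t - s) + s * s
    - (derive1 f t ^+ 2 - derive1 g t ^+ 2)); first by ring.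
  by rewrite w0 ss (meridian_unit_speed mer It); ring.
(* This factorization shows that the logarithm's argument is nonzero. As [1 + s f' = s (f' + s)],
   its logarithmic derivative is [s / f], so [h' = g' - k / f = 0]. *)
have wE : t + a + s * f t = f t * (derive1 f t + s).
  by rewrite -ff'//; ring.
have dw : is_derive t 1 (fun r => r + a + s * f r) (1 + s * derive1 f t).
  apply: (is_derive_eq (is_deriveD (is_deriveD (is_derive_id t 1)
    (is_derive_cst a t 1)) (is_deriveZ s (df It)))).
  by rewrite addr0.
have wt0 : t + a + s * f t != 0 by rewrite wE mulf_neq0.
have dlnw := is_derive_ln_norm (f := fun r => r + a + s * f r) wt0 dw.
apply: (is_derive_eq (is_deriveB (dg It) (is_deriveZ (k * s) dlnw))).
rewrite wE -(fg' t It) -ss.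
rewrite [X in _ - X](_ : _ = derive1 g t * (s * s)).
  by rewrite ss mulr1 subrr.
rewrite /GRing.scale/=; move: (derive1 f t) (derive1 g t) w0 => x y w0.
by field; rewrite w0 ft0.
Qed.

Lemma meridian_solution_ode a b (s : bool) :
  (forall u, I u -> f u = (-1) ^+ s * Num.sqrt (u ^+ 2 + 2 * a * u + b)) ->
  forall u, I u -> f u * derive1n 2 f u + derive1 f u ^+ 2 = 1 /\
                   f u * derive1n 2 g u + derive1 f u * derive1 g u = 0.
Proof.
move=> fE.
have f2 u : I u -> f u ^+ 2 - u ^+ 2 - 2 * a * u = b.
  move=> Iu; have := meridian_f_neq0 mer Iu.
  (* The square root of a nonpositive number is 0 by convention, so [f u != 0] forces a positive
     radicand and squaring recovers it. *)
  rewrite fE// mulf_eq0 signr_eq0/= sqrtr_eq0 -ltNge => /ltW q0.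
  by rewrite exprMn sqrr_sign mul1r sqr_sqrtr//; ring.
have ff' u : I u -> f u * derive1 f u - u = a.
  move=> Iu; have := derive_cst_on openI Iu f2
    (is_deriveB (is_deriveB (is_derive_sqr (df Iu))
      (is_derive_sqr (is_derive_id u 1)))
      (is_derive_mul (is_derive_cst (2 * a) u 1) (is_derive_id u 1))).
  rewrite /=; move: (derive1 f u) => x; lra.
move=> u Iu.
have ode1 : f u * derive1n 2 f u + derive1 f u ^+ 2 = 1.
  have := derive_cst_on openI Iu ff' (is_deriveB
    (is_derive_mul (df Iu) (ddf Iu)) (is_derive_id u 1)).
  by rewrite -expr2 => /eqP; rewrite subr_eq0 => /eqP.
(* Multiplying by [g'] allows [g' g''] to be replaced by [f' f'']; the result is [f'] times the
   difference of two quantities equal to 1. *)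
split=> //; apply: (mulfI (meridian_dg_neq0 mer Iu)); rewrite mulr0.
transitivity (f u * (derive1 g u * derive1n 2 g u)
  + derive1 f u * derive1 g u ^+ 2); first by ring.
rewrite -(meridian_speed_derive mer Iu).
transitivity (derive1 f u * ((f u * derive1n 2 f u + derive1 f u ^+ 2)
  - (derive1 f u ^+ 2 - derive1 g u ^+ 2))); first by ring.
by rewrite ode1 (meridian_unit_speed mer Iu) subrr mulr0.
Qed.

End MeridianMinimal.

Unset Implicit Arguments.

Theorem theorem2 (R : realType) (I J : set R) (f g : R -> R)
    (l : R -> 'rV[R]_4) :
  meridian_data I J f g l ->
  (minimal_surface I J (meridian_surface f g l) <->
   is_spherical_curvature J l (fun=> 0) /\
   (exists (a b C : R) (s1 s2 : bool),
      0 < a ^+ 2 - b /\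
      forall u : R, I u ->
        f u = (-1) ^+ s1 * Num.sqrt (u ^+ 2 + 2 * a * u + b) /\
        g u = (-1) ^+ s2 * Num.sqrt (a ^+ 2 - b)
                * ln `|u + a + Num.sqrt (u ^+ 2 + 2 * a * u + b)| + C)).
Proof.
move=> mer; split.
  move=> /(meridian_minimalP mer) [l''E ode].
  split; first exact/(spherical_curvature0P mer).
  exact: meridian_ode_solution mer ode.
move=> [/(spherical_curvature0P mer) l''E [a [b [C [s1 [s2 [_ fgE]]]]]]].
apply/(meridian_minimalP mer); split=> //.
by apply: (meridian_solution_ode mer (a := a) (b := b) (s := s1)) => u /fgE [].
Qed.
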